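(* Let $x$ be a positive rational number with even-length continued fraction expansion $a=[a_0;a_1,\dots,a_{2\ell-1}]$. The map $\Psi:\mathcal{J}(x)\to\mathcal{B}(a)$, $I\mapsto(\#(I\cap C_i(a)))_{0\leq i<2\ell}$, is an order-preserving bijection from $(\mathcal{J}(x),\subseteq)$ to $(\mathcal{B}(a),\leq)$ such that: (1) $I\in\mathcal{J}^\bullet(x)$ if and only if $\Psi(I)\in\mathcal{B}^\bullet(a)$; (2) $I\in\mathcal{J}^\circ(x)$ if and only if $\Psi(I)\in\mathcal{B}^\circ(a)$; (3) for every $I\in\mathcal{J}(x)$, $|I|=\Vert\Psi(I)\Vert_1$.
   Context: Even-length expansion: $\ell\geq1$, $a_0\geq0$, $a_i\geq1$ for $i\geq1$. $W(x)=\mathtt{1}^{a_0}\mathtt{0}^{a_1}\cdots\mathtt{1}^{a_{2\ell-2}}\mathtt{0}^{a_{2\ell-1}-1}$. For $w=w_1\cdots w_n\in\{\mathtt0,\mathtt1\}^*$, the fence poset $F(w)$ has elements $y_0,\dots,y_n$ and covering relations $y_{i-1}\lhd y_i$ if $w_i=\mathtt0$, $y_{i-1}\rhd y_i$ if $w_i=\mathtt1$. $\mathcal{F}(x)=F(W(x))$ has $a_0+\dots+a_{2\ell-1}$ elements, identified with their indices $0,1,\dots,a_0+\dots+a_{2\ell-1}-1$. $\mathcal{J}(x)$ is its set of lower order ideals; $\mathcal{J}^\bullet(x)$ / $\mathcal{J}^\circ(x)$ are those containing / not containing $0$. $C_i(a)=\{n\in\mathbb{N}: \sum_{k<i}a_k\leq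 n<\sum_{k\leq i}a_k\}$. A sequence $(b_i)_{0\le i<2\ell}$ is admissible for $a$ if $0\leq b_i\leq a_i$; if $i>0$ odd and $b_i=a_i$ then $b_{i-1}=a_{i-1}$; if $i>0$ even and $b_i=0$ then $b_{i-1}=0$. $\mathcal{B}(a)$ is the set of admissible sequences, ordered componentwise ($b\leq b'$ iff $b_i\leq b'_i$ for all $i$). $\mathcal{B}^\bullet(a)$: $b$ with ($b_0=a_0=0<b_1=a_1$) or $0<b_0$; $\mathcal{B}^\circ(a)$: $b$ with ($b_0=a_0=0\leq b_1<a_1$) or $0=b_0<a_0$. $\Vert b\Vert_1=\sum_i b_i$.
   Formalization: The fence order is reversed: y_{i-1} ◁ y_i is read as ''y_{i-1} covers y_i'', so letter 0 gives y_{i-1} > y_i and letter 1 gives y_{i-1} < y_i. With the usual reading the claim fails: for a=[1;1], the lower ideal {1} is sent to (0,1), which is not admissible. *)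

(* Defs.v *)
From HB Require Import structures.
From mathcomp Require Import all_boot all_order all_algebra.

Set Implicit Arguments.
Unset Strict Implicit.
Unset Printing Implicit Defensive.

Import Order.TTheory GRing.Theory Num.Theory.

Local Open Scope nat_scope.

(* [a_0; a_1, ..., a_k] = a_0 + 1 / [a_1; ..., a_k]. The convention 0^-1 = 0   *)
(* makes the empty tail contribute 0, so that [a_0] evaluates to a_0.          *)
Definition cf_value (a : seq nat) : rat :=
  foldr (fun c q => c%:R + q^-1)%R 0%R a.

Definition even_cf_expansion (x : rat) (l : nat) (a : seq nat) : Prop :=
  [/\ 0 < l,
      size a = l.*2,
      forall i, 0 < i < size a -> 0 < nth 0 a i
    & cf_value a = x].

(* The letter 1 is [true], the letter 0 is [false]. *)
Definition W (a : seq nat) : seq bool :=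
  flatten [seq nseq (if i == (size a).-1 then nth 0 a i - 1 else nth 0 a i)
                    (~~ odd i)
          | i <- iota 0 (size a)].

(* The carrier {y_0, ..., y_n} of F(w), for n = size w. *)
Definition fence (w : seq bool) : Type := 'I_(size w).+1.

HB.instance Definition _ (w : seq bool) := Finite.on (fence w).

Definition fence_index (w : seq bool) (y : fence w) : nat := nat_of_ord y.

(* The relation y <| z of the fence: y_{i-1} <| y_i if w_i = 0 and             *)
(* y_{i-1} |> y_i, i.e. y_i <| y_{i-1}, if w_i = 1, where w_i is               *)
(* nth false w i.-1. Here y <| z is read "y covers z", so z is the smaller     *)
(* element. Under the opposite reading, counting the elements of a lower ideal *)
(* in the blocks C_i below need not give an admissible sequence: for           *)
(* a = [1; 1] the ideal {1} would be sent to (0, 1).                           *)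
Definition fence_covers (w : seq bool) : rel (fence w) :=
  fun y z =>
    [|| (fence_index z == (fence_index y).+1)
          && (nth false w (fence_index y) == false)
      | (fence_index y == (fence_index z).+1)
          && (nth false w (fence_index z) == true)].

Definition fence_le (w : seq bool) : rel (fence w) :=
  fun z y => connect (@fence_covers w) y z.

Lemma fence_le_refl (w : seq bool) : reflexive (@fence_le w).
Proof. by move=> y; apply: connect0. Qed.

Lemma fence_le_trans (w : seq bool) : transitive (@fence_le w).
Proof. by move=> y x z xy yz; apply: connect_trans yz xy. Qed.

(* The order is antisymmetric because the height below decreases strictly      *)
(* along covering pairs.                                                       *)
Definition fence_height (w : seq bool) (y : fence w) : nat :=
  size w + count_mem true (take (fence_index y) w)
    - count_mem false (take (fence_index y) w).

Lemma fence_height_covers (w : seq bool) (y z : fence w) :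
  fence_covers y z -> fence_height z < fence_height y.
Proof.
have step (u v : fence w) (b : bool) :
    fence_index v = (fence_index u).+1 -> nth false w (fence_index u) = b ->
    if b then fence_height u < fence_height v
    else fence_height v < fence_height u.
  move=> uv wu; rewrite /fence_height uv.
  have lt_uw : fence_index u < size w.
    by have := ltn_ord v; rewrite -/(fence_index v) uv ltnS.
  rewrite (take_nth false lt_uw) wu -cats1 !count_cat /=.
  have le_cw : count_mem false (take (fence_index u) w) < size w.
    apply: leq_ltn_trans (count_size _ _) _.
    by rewrite size_take lt_uw.
  case: b {wu} => /=; rewrite !(addn0, addn1) ?addnS.
    by rewrite subSn ?ltnSn // (leq_trans (ltnW le_cw)) // leq_addr.
  by rewrite ltn_sub2l // (leq_trans le_cw) // leq_addr.
case/orP=> /andP[/eqP yz /eqP wyz]; first exact: (step y z false).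
exact: (step z y true).
Qed.

Lemma fence_le_anti (w : seq bool) : antisymmetric (@fence_le w).
Proof.
have le_height (y z : fence w) :
    connect (@fence_covers w) y z -> y = z \/ fence_height z < fence_height y.
  case/connectP=> p; elim: p y => [|t p IHp] y /=; first by left.
  case/andP=> /fence_height_covers lt_ty /IHp{}IHp /IHp[<-|lt_zt]; right=> //.
  exact: ltn_trans lt_ty.
move=> y z /andP[/le_height[-> //|lt_yz] /le_height[-> //|lt_zy]].
by have := ltn_trans lt_yz lt_zy; rewrite ltnn.
Qed.

Fact fence_display : Order.disp_t. Proof. by []. Qed.

HB.instance Definition _ (w : seq bool) :=
  Order.Le_isPOrder.Build fence_display (fence w)
    (@fence_le_refl w) (@fence_le_anti w) (@fence_le_trans w).

Definition lower_ideal (w : seq bool) (I : {set fence w}) : Prop :=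
  forall y z : fence w, y \in I -> (z <= y)%O -> z \in I.

Definition J (a : seq nat) (I : {set fence (W a)}) : Prop := lower_ideal I.

Definition Jbullet (a : seq nat) (I : {set fence (W a)}) : Prop :=
  J I /\ (ord0 : fence (W a)) \in I.

Definition Jcirc (a : seq nat) (I : {set fence (W a)}) : Prop :=
  J I /\ (ord0 : fence (W a)) \notin I.

Definition C (a : seq nat) (i : nat) : pred nat :=
  fun n => \sum_(k < i) nth 0 a k <= n < \sum_(k < i.+1) nth 0 a k.

Definition admissible (a b : seq nat) : Prop :=
  size b = size a /\
  forall i, i < size a ->
    [/\ nth 0 b i <= nth 0 a i,
        0 < i -> odd i -> nth 0 b i = nth 0 a i ->
          nth 0 b i.-1 = nth 0 a i.-1
      & 0 < i -> ~~ odd i -> nth 0 b i = 0 -> nth 0 b i.-1 = 0].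

Definition B (a b : seq nat) : Prop := admissible a b.

Definition leB (b b' : seq nat) : Prop := forall i, nth 0 b i <= nth 0 b' i.

Definition Bbullet (a b : seq nat) : Prop :=
  B a b /\
  ([/\ nth 0 b 0 = nth 0 a 0, nth 0 a 0 = 0,
       0 < nth 0 b 1 & nth 0 b 1 = nth 0 a 1]
   \/ 0 < nth 0 b 0).

Definition Bcirc (a b : seq nat) : Prop :=
  B a b /\
  ([/\ nth 0 b 0 = nth 0 a 0, nth 0 a 0 = 0,
       0 <= nth 0 b 1 & nth 0 b 1 < nth 0 a 1]
   \/ (0 = nth 0 b 0 /\ nth 0 b 0 < nth 0 a 0)).

Definition Psi (a : seq nat) (I : {set fence (W a)}) : seq nat :=
  [seq #|[set y in I | C a i (fence_index y)]| | i <- iota 0 (size a)].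

(* Main.v *)
(* A letter 0 makes each index cover its successor and a letter 1 makes it     *)
(* covered by its successor, so a lower ideal meets an even block C_i in an    *)
(* initial segment and an odd block in a final segment. It is therefore        *)
(* determined by the block counts b_i, and closure across the boundaries of    *)
(* consecutive blocks is exactly admissibility.                                *)
Require Import Defs.
From mathcomp Require Import all_boot all_order all_algebra.
From mathcomp Require Import zify.

Set Implicit Arguments.
Unset Strict Implicit.
Unset Printing Implicit Defensive.

Definition psum (a : seq nat) (i : nat) : nat := \sum_(k < i) nth 0 a k.

Lemma psum0 a : psum a 0 = 0.
Proof. by rewrite /psum big_ord0. Qed.

Lemma psumS a i : psum a i.+1 = psum a i + nth 0 a i.
Proof. by rewrite /psum big_ord_recr. Qed.

Lemma leq_psum a i j : i <= j -> psum a i <= psum a j.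
Proof.
by elim: j => [|j IHj]; rewrite leq_eqVlt => /predU1P[-> //|// /IHj]; rewrite psumS; lia.
Qed.

Lemma CE a i n : C a i n = (psum a i <= n < psum a i + nth 0 a i).
Proof. by rewrite -psumS. Qed.

Lemma C_inj a i j n : C a i n -> C a j n -> i = j.
Proof.
rewrite !CE -!psumS => ni nj; have [ltij|ltji|//] := ltngtP i j.
  by have := leq_psum a ltij; lia.
by have := leq_psum a ltji; lia.
Qed.

Lemma C_cover a m n : n < psum a m -> exists2 i, i < m & C a i n.
Proof.
elim: m => [|m IHm]; rewrite ?psum0 // psumS => lt_n.
have [/IHm[i lt_im Cin]|le_mn] := ltnP n (psum a m).
  by exists i => //; apply: leqW.
by exists m; rewrite // CE le_mn.
Qed.

Lemma size_flatten_nseq (f : nat -> nat) (g : nat -> bool) m :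
  size (flatten [seq nseq (f i) (g i) | i <- iota 0 m]) = \sum_(k < m) f k.
Proof.
elim: m => [|m IHm]; first by rewrite big_ord0.
by rewrite -addn1 iotaD map_cat flatten_cat size_cat IHm /= cats0 size_nseq
  add0n addn1 big_ord_recr.
Qed.

Lemma nth_flatten_nseq (f : nat -> nat) (g : nat -> bool) m i n :
    i < m -> \sum_(k < i) f k <= n < \sum_(k < i.+1) f k ->
  nth false (flatten [seq nseq (f i) (g i) | i <- iota 0 m]) n = g i.
Proof.
move=> lt_im /andP[le_n lt_n].
have -> : m = i + (1 + (m - i.+1)) by lia.
rewrite !iotaD !map_cat !flatten_cat /= cats0 add0n nth_cat size_flatten_nseq.
have lt_nf : n - \sum_(k < i) f k < f i.
  by rewrite ltn_subLR //; move: lt_n; rewrite big_ord_recr.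
by rewrite ltnNge le_n /= nth_cat size_nseq lt_nf nth_nseq lt_nf.
Qed.

Section Word.

Variable a : seq nat.
Hypothesis last_gt0 : 0 < nth 0 a (size a).-1.

Let f i := if i == (size a).-1 then nth 0 a i - 1 else nth 0 a i.

Let size_gt0 : 0 < size a.
Proof. by case: a last_gt0. Qed.

Let sum_f i : i < size a -> \sum_(k < i) f k = psum a i.
Proof. by move=> lt_i; apply: eq_bigr => k _; rewrite /f ifN //; have := ltn_ord k; lia. Qed.

Lemma size_W : (size (W a)).+1 = psum a (size a).
Proof.
rewrite /W (size_flatten_nseq f (fun i => ~~ odd i)).
rewrite -(prednK size_gt0) big_ord_recr sum_f ?prednK // -[in RHS](prednK size_gt0).
by rewrite psumS /= /f eqxx; lia.
Qed.

Lemma nth_W i n :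
  i < size a -> C a i n -> n < size (W a) -> nth false (W a) n = ~~ odd i.
Proof.
move=> lt_i; rewrite CE => Cin; rewrite -ltnS size_W => lt_n.
apply: (nth_flatten_nseq (f := f)) => //.
rewrite big_ord_recr sum_f //= /f; case: eqP => [i_last|_ //].
by move: lt_n; rewrite -(prednK size_gt0) psumS -i_last; lia.
Qed.

End Word.

Lemma count_initial (p : pred nat) m k :
    (forall n, m <= n -> n.+1 < m + k -> p n.+1 -> p n) ->
  forall n, m <= n < m + k -> p n = (n < m + count p (iota m k)).
Proof.
elim: k m => [|k IHk] m down n; first by lia.
have {}IHk := IHk m.+1 (fun n le_n lt_n => down n (ltnW le_n) ltac:(lia)).
have count0 : p m = false -> count p (iota m.+1 k) = 0.
  move=> pm; apply/eqP/contraT; rewrite -lt0n => count_gt0.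
  have := count_size p (iota m.+1 k); rewrite size_iota => le_k.
  by rewrite -pm; apply: down; rewrite ?IHk //; lia.
rewrite /=; case: (ltngtP m n) => // [lt_mn lt_n|<- _].
  by rewrite IHk; [move: count0; case: (p m) => [_|->//]; lia | lia].
by move: count0; case: (p m) => [_|->//]; lia.
Qed.

Lemma count_final (p : pred nat) m k :
    (forall n, m <= n -> n.+1 < m + k -> p n -> p n.+1) ->
  forall n, m <= n < m + k -> p n = (m + k <= n + count p (iota m k)).
Proof.
move=> up n le_n.
have /count_initial/(_ n le_n) /= : forall n, m <= n -> n.+1 < m + k ->
    predC p n.+1 -> predC p n by move=> j mj jk; apply/contra/up.
by have := count_predC p (iota m k); rewrite size_iota; case: (p n); lia.
Qed.

Lemma count_ltn_iota m c k : c <= k -> count (fun n => n < m + c) (iota m k) = c.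
Proof.
move=> le_ck; rewrite -(subnKC le_ck) iotaD count_cat.
rewrite (eq_in_count (a2 := predT)) => [|n]; last by rewrite mem_iota /=; lia.
rewrite count_predT size_iota (eq_in_count (a2 := pred0)) => [|n].
  by rewrite count_pred0 addn0.
by rewrite mem_iota /=; lia.
Qed.

Lemma count_geq_iota m c k :
  c <= k -> count (fun n => m + k <= n + c) (iota m k) = c.
Proof.
move=> le_ck; have := count_predC (fun n => m + k <= n + c) (iota m k).
have /eq_count -> : predC (fun n => m + k <= n + c) =1 (fun n => n < m + (k - c)).
  by move=> n /=; lia.
by rewrite size_iota count_ltn_iota; lia.
Qed.

Definition block_mem (a b : seq nat) (i n : nat) : bool :=
  if odd i then psum a i.+1 <= n + nth 0 b i else n < psum a i + nth 0 b i.

Definition ideal_pred (a b : seq nat) (n : nat) : bool :=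
  has (fun i => C a i n && block_mem a b i n) (iota 0 (size a)).

Lemma ideal_predE a b i n :
  i < size a -> C a i n -> ideal_pred a b n = block_mem a b i n.
Proof.
move=> lt_i Cin; apply/hasP/idP => [[j _ /andP[Cjn]]|in_n].
  by rewrite (C_inj Cin Cjn).
by exists i; rewrite ?mem_iota ?Cin.
Qed.

Lemma lower_ideal_covers w (I : {set fence w}) :
  lower_ideal I <-> (forall y z, y \in I -> fence_covers y z -> z \in I).
Proof.
split=> [low y z Iy yz|low y z Iy].
  by apply: low Iy _; apply: connect1.
case/connectP=> p; elim: p y Iy => [|t p IHp] y Iy /=; first by move=> _ ->.
by case/andP=> yt; apply: IHp; apply: low yt.
Qed.

Definition idx_mem w (I : {set fence w}) (n : nat) : bool :=
  (inord n : fence w) \in I.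

Lemma idx_mem_index w (I : {set fence w}) y : idx_mem I (fence_index y) = (y \in I).
Proof. by rewrite /idx_mem /fence_index inord_val. Qed.

Lemma card_idx_mem w (I : {set fence w}) (P : pred nat) :
  #|[set y in I | P (fence_index y)]| = count (predI (idx_mem I) P) (iota 0 (size w).+1).
Proof.
rewrite -val_enum_ord count_map -(size_filter _ (enum _)) cardE /enum_mem.
rewrite -enumT -filter_predI; congr size; apply: eq_filter => y /=.
by rewrite !inE andbT /idx_mem inord_val.
Qed.

Lemma sumn_count_blocks (p : pred nat) a m :
  sumn [seq count p (iota (psum a i) (nth 0 a i)) | i <- iota 0 m]
    = count p (iota 0 (psum a m)).
Proof.
elim: m => [|m IHm]; first by rewrite psum0.
by rewrite -addn1 iotaD map_cat sumn_cat IHm /= addn0 add0n addn1 psumS iotaD count_cat.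
Qed.

Section Ideals.

Variable a : seq nat.
Hypothesis size_gt1 : 1 < size a.
Hypothesis a_gt0 : forall i, 0 < i < size a -> 0 < nth 0 a i.

Let last_gt0 : 0 < nth 0 a (size a).-1.
Proof. by apply: a_gt0; lia. Qed.

Let C_lt i n : i < size a -> C a i n -> n < (size (W a)).+1.
Proof.
by rewrite CE -psumS size_W // => /(leq_psum a) le_i; lia.
Qed.

Lemma block_index n : n < (size (W a)).+1 -> exists2 i, i < size a & C a i n.
Proof. by rewrite size_W //; apply: C_cover. Qed.

Lemma lower_ideal_step (I : {set fence (W a)}) :
  J I <-> (forall i n, i < size a -> C a i n -> n.+1 < (size (W a)).+1 ->
           if odd i then idx_mem I n -> idx_mem I n.+1
           else idx_mem I n.+1 -> idx_mem I n).
Proof.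
rewrite /J lower_ideal_covers; split=> [closed i n lt_i Cin lt_n|closed y z Iy].
  have nthW := nth_W last_gt0 lt_i Cin lt_n.
  have lt_n' := ltnW lt_n.
  by case: ifP nthW => odd_i nthW /closed; apply;
    rewrite /fence_covers /fence_index !inordK // eqxx nthW // orbT.
case/orP=> /andP[/eqP yz /eqP nthW].
  have lt_z := ltn_ord z; have [i lt_i Ciy] := block_index (ltn_ord y).
  rewrite -[nat_of_ord z]/(fence_index z) yz in lt_z.
  move: (closed i _ lt_i Ciy lt_z); rewrite (nth_W last_gt0 lt_i Ciy lt_z) in nthW.
  by rewrite (negbFE nthW) -[y.+1]yz !idx_mem_index => ->.
have lt_y := ltn_ord y; have [i lt_i Ciz] := block_index (ltn_ord z).
rewrite -[nat_of_ord y]/(fence_index y) yz in lt_y.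
move: (closed i _ lt_i Ciz lt_y); rewrite (nth_W last_gt0 lt_i Ciz lt_y) in nthW.
by rewrite (negbTE nthW) -[z.+1]yz !idx_mem_index => ->.
Qed.

Lemma size_Psi (I : {set fence (W a)}) : size (Psi I) = size a.
Proof. by rewrite size_map size_iota. Qed.

Lemma nth_Psi (I : {set fence (W a)}) i : i < size a ->
  nth 0 (Psi I) i = count (idx_mem I) (iota (psum a i) (nth 0 a i)).
Proof.
move=> lt_i; rewrite (nth_map 0) ?size_iota // nth_iota // add0n card_idx_mem.
rewrite size_W // -(subnKC (leq_psum a lt_i)) psumS !iotaD !count_cat !add0n.
have out m k : ~~ has (C a i) (iota m k) ->
    count (predI (idx_mem I) (C a i)) (iota m k) = 0.
  move=> out; apply/eqP; rewrite -leqn0 leqNgt -has_count.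
  by apply: contra out; apply: sub_has => n /andP[].
rewrite (out 0) ?(out (psum a i + _)) ?addn0 ?add0n; last 2 first.
- by apply/hasPn => n; rewrite mem_iota CE; lia.
- by apply/hasPn => n; rewrite mem_iota CE; lia.
by apply: eq_in_count => n; rewrite mem_iota /= CE => ->; rewrite andbT.
Qed.

Lemma idx_mem_block (I : {set fence (W a)}) i n :
  J I -> i < size a -> C a i n -> idx_mem I n = block_mem a (Psi I) i n.
Proof.
move/lower_ideal_step=> step lt_i Cin; rewrite /block_mem nth_Psi // psumS.
have lt_N := C_lt lt_i.
case: ifP => odd_i; [apply: count_final | apply: count_initial]; rewrite -?CE //.
  move=> j le_j lt_j; move: (step i j lt_i); rewrite odd_i; apply.
    by rewrite CE; lia.
  by apply: lt_N; rewrite CE; lia.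
move=> j le_j lt_j; move: (step i j lt_i); rewrite odd_i; apply.
  by rewrite CE; lia.
by apply: lt_N; rewrite CE; lia.
Qed.

Lemma Psi_B (I : {set fence (W a)}) : J I -> B a (Psi I).
Proof.
move=> JI; have /lower_ideal_step step := JI; split=> [|i lt_i].
  exact: size_Psi.
have le_ba j : j < size a -> nth 0 (Psi I) j <= nth 0 a j.
  by move=> lt_j; rewrite nth_Psi // -[leqRHS](size_iota (psum a j)) count_size.
split; first exact: le_ba.
all: case: i lt_i => // i lt_i _ odd_i b_i /=.
all: have lt_i' := ltnW lt_i; have le_b := le_ba i lt_i'.
all: have ai_gt0 := a_gt0 (i := i.+1) lt_i.
all: have [a0|ai'_gt0] := posnP (nth 0 a i); first by lia.
all: have Cin : C a i (psum a i.+1).-1 by rewrite CE psumS; lia.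
all: have psum_gt0 : 0 < psum a i.+1 by rewrite psumS; lia.
all: have Cin1 : C a i.+1 (psum a i.+1) by rewrite CE; lia.
all: have := step i _ lt_i' Cin; rewrite prednK // => /(_ (C_lt lt_i Cin1)).
all: rewrite (idx_mem_block JI lt_i' Cin) (idx_mem_block JI lt_i Cin1).
all: rewrite /block_mem /= in odd_i *.
  by rewrite odd_i (negbTE odd_i) !psumS; lia.
by rewrite (negbNE odd_i) !psumS /=; lia.
Qed.

Lemma Psi_surj b : B a b -> exists2 I : {set fence (W a)}, J I & Psi I = b.
Proof.
case=> size_b adm; pose I := [set y : fence (W a) | ideal_pred a b (fence_index y)].
have memI i n : i < size a -> C a i n -> idx_mem I n = block_mem a b i n.
  move=> lt_i Cin; rewrite /idx_mem inE /fence_index inordK; last exact: C_lt Cin.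
  exact: ideal_predE.
exists I.
  apply/lower_ideal_step => i n lt_i Cin lt_n; rewrite (memI i n) //.
  have [j lt_j Cjn1] := block_index lt_n; rewrite (memI j) //.
  have [eq_ij|ne_ij] := eqVneq i j.
    by rewrite /block_mem -eq_ij; case: (odd i); lia.
  have eq_n : n.+1 = psum a i.+1.
    move: Cin; rewrite CE -psumS => /andP[le_n]; rewrite leq_eqVlt => /predU1P[//|lt_ni].
    have Cin1 : C a i n.+1 by rewrite CE -psumS; lia.
    by rewrite (C_inj Cin1 Cjn1) eqxx in ne_ij.
  have lt_i1 : i.+1 < size a.
    rewrite ltn_neqAle lt_i andbT; apply: contraL lt_n => /eqP eq_i.
    by rewrite -leqNgt size_W // -eq_i eq_n.
  have Ci1 : C a i.+1 n.+1.
    by rewrite eq_n CE; have := a_gt0 (i := i.+1) lt_i1; lia.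
  rewrite -(C_inj Ci1 Cjn1) /block_mem /=.
  have [le_i _ _] := adm i lt_i; have [le_i1] := adm i.+1 lt_i1.
  move=> /(_ isT) /= odd_b /(_ isT) even_b.
  move: odd_b even_b; rewrite /= negbK.
  case: (odd i) => /= odd_b even_b; rewrite eq_n !psumS.
    by have {odd_b} := even_b isT; move: eq_n; rewrite psumS; lia.
  by have {even_b} := odd_b isT; move: eq_n; rewrite psumS; lia.
apply: (@eq_from_nth _ 0); rewrite size_Psi // => i lt_i; rewrite nth_Psi //.
have [le_b _ _] := adm i lt_i.
have /eq_in_count -> : {in iota (psum a i) (nth 0 a i), idx_mem I =1 block_mem a b i}.
  by move=> n; rewrite mem_iota -CE; apply: memI.
rewrite /block_mem; case: (odd i); first by rewrite psumS count_geq_iota.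
exact: count_ltn_iota.
Qed.

Lemma Psi_inj (I I' : {set fence (W a)}) : J I -> J I' -> Psi I = Psi I' -> I = I'.
Proof.
move=> JI JI' eq_Psi; apply/setP => y.
have [i lt_i Ciy] := block_index (ltn_ord y).
by rewrite -!idx_mem_index !(idx_mem_block _ lt_i Ciy) // eq_Psi.
Qed.

Lemma Psi_mono (I I' : {set fence (W a)}) : I \subset I' -> leB (Psi I) (Psi I').
Proof.
move=> sII' i; have [lt_i|le_i] := ltnP i (size a); last first.
  by rewrite !nth_default ?size_Psi.
by rewrite !nth_Psi //; apply: sub_count => n; apply: (subsetP sII').
Qed.

Lemma card_Psi (I : {set fence (W a)}) : #|I| = sumn (Psi I).
Proof.
have -> : Psi I = [seq count (idx_mem I) (iota (psum a i) (nth 0 a i)) | i <- iota 0 (size a)].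
  apply: (@eq_from_nth _ 0); rewrite !size_map // size_iota => i lt_i.
  by rewrite nth_Psi // (nth_map 0) ?size_iota // nth_iota.
rewrite sumn_count_blocks -size_W //.
have := card_idx_mem I predT.
rewrite (eq_count (a2 := idx_mem I)) => [<-|n /=]; last by rewrite andbT.
by apply: eq_card => y; rewrite inE andbT.
Qed.

Lemma mem0_Psi (I : {set fence (W a)}) : J I ->
  (ord0 : fence (W a)) \in I
    = if nth 0 a 0 == 0 then nth 0 a 1 <= nth 0 (Psi I) 1 else 0 < nth 0 (Psi I) 0.
Proof.
move=> JI; rewrite -idx_mem_index; case: eqP => a0.
  rewrite (idx_mem_block JI size_gt1) ?/block_mem ?CE ?psumS ?psum0 /=; first by lia.
  by have := a_gt0 (i := 1) size_gt1; rewrite /fence_index /=; lia.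
by rewrite (idx_mem_block JI (ltnW size_gt1)) ?/block_mem ?CE ?psum0 //=; lia.
Qed.

Lemma Psi_bullet (I : {set fence (W a)}) : J I -> Jbullet I <-> Bbullet a (Psi I).
Proof.
move=> JI; have BI := Psi_B JI; rewrite /Jbullet /Bbullet mem0_Psi //.
have [_ adm] := BI.
have [le0 _ _] := adm 0 (ltnW size_gt1); have [le1 _ _] := adm 1 size_gt1.
have a1 := a_gt0 (i := 1) size_gt1.
case: eqP => a0; split=> [[_ ?]|[_ [[? ? ? ?]|?]]]; split=> //; try lia.
by left; split; lia.
Qed.

Lemma Psi_circ (I : {set fence (W a)}) : J I -> Jcirc I <-> Bcirc a (Psi I).
Proof.
move=> JI; have BI := Psi_B JI; rewrite /Jcirc /Bcirc mem0_Psi //.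
have [_ adm] := BI.
have [le0 _ _] := adm 0 (ltnW size_gt1).
case: eqP => a0; split=> [[_ ?]|[_ [[? ? ? ?]|[? ?]]]]; split=> //; try lia.
by left; split; lia.
Qed.

End Ideals.

Theorem theorem5p2 (x : rat) (l : nat) (a : seq nat)
    (x_gt0 : (0 < x)%R) (a_exp : even_cf_expansion x l a) :
  [/\ (* Psi is a map from J(x) to B(a) *)
      forall I : {set fence (W a)}, J I -> B a (Psi I),
      (* injective *)
      forall I I' : {set fence (W a)}, J I -> J I' -> Psi I = Psi I' -> I = I',
      (* surjective *)
      forall b : seq nat, B a b -> exists2 I : {set fence (W a)}, J I & Psi I = b
      (* order-preserving *)
    & forall I I' : {set fence (W a)},
        J I -> J I' -> I \subset I' -> leB (Psi I) (Psi I')]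
  /\ [/\ forall I : {set fence (W a)},
           J I -> (Jbullet I <-> Bbullet a (Psi I)),
         forall I : {set fence (W a)},
           J I -> (Jcirc I <-> Bcirc a (Psi I))
       & forall I : {set fence (W a)}, J I -> #|I| = sumn (Psi I)].
Proof.
case: a_exp => l_gt0 size_a a_gt0 _.
have size_gt1 : 1 < size a by lia.
split; split.
- exact: Psi_B.
- exact: Psi_inj.
- exact: Psi_surj.
- by move=> I I' _ _; apply: Psi_mono.
- exact: Psi_bullet.
- exact: Psi_circ.
- by move=> I _; apply: card_Psi.
Qed.
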